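(* Let $P\in\mathbb R^{n\times n}$ be a row-stochastic matrix and let $\boldsymbol v=(v_1,\ldots,v_n)^{\mathrm T}$ be a distribution vector, i.e. $v_i\ge0$ for all $i$ and $\sum_{i=1}^n v_i=1$. For $0<\delta\le1$ put $\gamma=\delta^{-1}-1$ and $$Q_{\delta,\boldsymbol v}=\begin{pmatrix}(1-\delta)P&\delta\mathbf 1\\ \boldsymbol v^{\mathrm T}&0\end{pmatrix}\in\mathbb R^{(n+1)\times(n+1)}.$$ If a sequence $\{\boldsymbol y^k\}$ of vectors in $\mathbb R^{n+1}$ satisfies $\boldsymbol y^{k+1}=Q_{\delta,\boldsymbol v}\,\boldsymbol y^k$, $k=0,1,\ldots$, then, denoting by $\bar J=(\bar J_{ij})_{n\times n}=(I-P)^\vdash$ the eigenprojection of $I-P$, we have: 1. $\displaystyle\lim_{k\to\infty}\boldsymbol y^k=\mathbf 1'\,\frac{1}{1+\delta}\Big[\boldsymbol v^{\mathrm T}\big(I+\gamma(I-P)\big)^{-1}\;\;\delta\Big]\boldsymbol y^0$; 2. $\displaystyle\lim_{\delta\to+0}\lim_{k\to\infty}\boldsymbol y^k=\mathbf 1'\big[\boldsymbol v^{\mathrm T}\bar J\;\;0\big]\boldsymbol y^0$; 3. if $\boldsymbol v=\tfrac1n\mathbf 1$, then $\displaystyle\lim_{\delta\to+0}\lim_{k\to\infty}\boldsymbol y^k=\mathbf 1'\,\frac1n\sum_{j=1}^n\bar J_{\cdot j}\,\boldsymbol y^0_j$, where $\bar J_{\cdot j}=\sum_{i=1}^n\bar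 J_{ij}$ and $\boldsymbol y^0_j$ is the $j$th component of $\boldsymbol y^0$.
   Context: For a square matrix $A$ let $\nu$ be its index, i.e. the smallest $k\in\{0,1,\ldots\}$ with $\operatorname{rank}A^{k+1}=\operatorname{rank}A^k$ (where $A^0=I$); the eigenprojection $A^\vdash$ of $A$ (corresponding to the eigenvalue $0$) is the unique idempotent matrix with range $\mathcal R(A^\vdash)=\mathcal N(A^\nu)$ and null space $\mathcal N(A^\vdash)=\mathcal R(A^\nu)$, where $\mathcal R$ and $\mathcal N$ denote range and null space. $\mathbf 1$ and $\mathbf 1'$ are the all-ones column vectors of length $n$ and $n+1$, respectively; $I$ is the identity matrix of order $n$. For a row vector $u$ of length $n$ and a scalar $c$, $[u\;\;c]$ is the row vector of length $n+1$ obtained by appending $c$ to $u$.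
   Formalization: Item 1 fails at δ=1 (n=1, P=(1), v=(1), y^0=(1,0)^T alternates and has no limit), so at δ=1 only, convergence of the sequence y^k is assumed and the limit formula is then proved; for 0<δ<1 it is unconditional. *)

(* Defs.v *)
From HB Require Import structures.
From mathcomp Require Import all_boot all_order all_algebra.
From mathcomp Require Import all_classical all_reals all_analysis.

Set Implicit Arguments.
Unset Strict Implicit.
Unset Printing Implicit Defensive.

Import Order.TTheory GRing.Theory Num.Theory.
Import numFieldNormedType.Exports.

Local Open Scope classical_set_scope.
Local Open Scope ring_scope.

Section Eigenprojection.
Context {F : fieldType} {n : nat}.
Implicit Types A E : 'M[F]_n.

Lemma mxrank_exp_le A k : (\rank (A ^+ k.+1) <= \rank (A ^+ k))%N.
Proof. by rewrite exprS; exact: mxrankM_maxr. Qed.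

Lemma mxindex_subproof A :
  exists k, \rank (A ^+ k.+1) == \rank (A ^+ k).
Proof.
have [//|noidx] := pselect (exists k, \rank (A ^+ k.+1) == \rank (A ^+ k)).
have dec k : (\rank (A ^+ k) + k <= n)%N.
  elim: k => [|k IHk]; first by rewrite addn0 rank_leq_row.
  apply: leq_trans IHk; rewrite addnS -addSn leq_add2r.
  rewrite ltn_neqAle mxrank_exp_le andbT.
  by apply/negP => eqk; apply: noidx; exists k.
by have := dec n.+1; rewrite addnS ltnNge leq_addl.
Qed.

Definition mxindex A : nat := ex_minn (mxindex_subproof A).

(* Matrices act on column vectors here, whereas the subspaces of mxalgebra are
   row spaces. *)
Definition mxrange A : set 'cV[F]_n := range (fun x : 'cV[F]_n => A *m x).
Definition mxnull A : set 'cV[F]_n := [set x | A *m x = 0].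

Definition is_eigenprojection A E : Prop :=
  [/\ E *m E = E,
      mxrange E = mxnull (A ^+ mxindex A) &
      mxnull E = mxrange (A ^+ mxindex A)].

(* The default value 0 is never used: see eigenprojectionP. *)
Definition eigenprojection A : 'M[F]_n := xget 0 [set E | is_eigenprojection A E].

Lemma mxrank_exp_stable A k :
  \rank (A ^+ (mxindex A + k)) = \rank (A ^+ mxindex A).
Proof.
rewrite /mxindex; case: ex_minnP => m /eqP eqm _.
have sub : (A ^+ m <= A ^+ m.+1)%MS.
  have le_m : (A ^+ m.+1 <= A ^+ m)%MS by rewrite exprS submxMl.
  by rewrite -(mxrank_leqif_sup le_m).2 eqm.
elim: k => [|k IHk]; first by rewrite addn0.
apply/eqP; rewrite eqn_leq; apply/andP; split.
  by rewrite -IHk addnS mxrank_exp_le.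
rewrite -{1}IHk addnS; apply: mxrankS.
by rewrite exprD -addSn exprD; apply: submxMr.
Qed.

Lemma eigenprojection_exists A : exists E, is_eigenprojection A E.
Proof.
set B := A ^+ mxindex A.
have rkBB : \rank (B *m B) = \rank B by rewrite -[_ *m _]exprD mxrank_exp_stable.
pose C := B^T; pose K := kermx C.
have rkCC : \rank (C *m C) = \rank C by rewrite -trmx_mul !mxrank_tr.
have capKC : (K :&: C)%MS = 0.
  apply/eqP; rewrite capmxC -mxrank_eq0.
  have := mxrank_mul_ker C C; rewrite rkCC => /eqP.
  by rewrite -[X in _ == X]addn0 eqn_add2l.
have sumKC : row_full (K + C)%MS.
  rewrite /row_full; have := mxrank_sum_cap K C.
  rewrite capKC mxrank0 addn0 => ->.
  by rewrite mxrank_ker subnK // rank_leq_row.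
have projK : (proj_mx K C <= K)%MS by rewrite -[proj_mx K C]mul1mx proj_mx_sub.
pose E := (proj_mx K C)^T.
have EE : E *m E = E.
  rewrite /E -trmx_mul; congr trmx.
  by apply: proj_mx_id; first exact: capKC.
have BE : B *m E = 0.
  apply: trmx_inj; rewrite trmx_mul trmx0 trmxK.
  by apply/eqP; rewrite -sub_kermx.
have EB : E *m B = 0.
  by apply: trmx_inj; rewrite trmx_mul trmx0 trmxK proj_mx_0.
have EI x : B *m x = 0 -> E *m x = x.
  move=> Bx0; apply: trmx_inj; rewrite trmx_mul trmxK.
  apply: proj_mx_id => //; rewrite sub_kermx -trmx_mul Bx0.
  by rewrite trmx0.
exists E; split=> //; apply/seteqP; split=> x /=.
- by move=> [z _ <-]; rewrite /mxnull /= mulmxA BE mul0mx.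
- by move=> Bx0; exists x => //; apply: EI.
- move=> Ex0.
  have : (x^T <= K + C)%MS by rewrite submx_full.
  move=> /(add_proj_mx capKC); rewrite -[proj_mx K C]trmxK -trmx_mul -/E.
  rewrite Ex0 trmx0 add0r => defx.
  have /submxP[D xD] : (x^T <= C)%MS by rewrite -defx proj_mx_sub.
  by exists D^T => //; apply: trmx_inj; rewrite trmx_mul trmxK -xD.
- by move=> [z _ <-]; rewrite /mxnull /= mulmxA EB mul0mx.
Qed.

Lemma eigenprojection_unique A E1 E2 :
  is_eigenprojection A E1 -> is_eigenprojection A E2 -> E1 = E2.
Proof.
move=> [idE1 rE1 nE1] [idE2 rE2 nE2].
have colP' (B C : 'M[F]_n) : (forall j, col j B = col j C) -> B = C.
  by move=> BC; apply/matrixP => i j; have /colP/(_ i) := BC j; rewrite !mxE.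
have E21 : E2 *m E1 = E1.
  apply: colP' => j.
  have : mxrange E2 (col j E1).
    by rewrite rE2 -rE1 colE; exists (delta_mx j 0).
  move=> [z _ ez]; rewrite -ez colE -mulmxA -colE -ez.
  by rewrite mulmxA idE2.
have E22 : E2 *m (1%:M - E1) = 0.
  apply: colP' => j.
  have : mxnull E2 (col j (1%:M - E1)).
    by rewrite nE2 -nE1 /mxnull /= colE mulmxA mulmxBr mulmx1 idE1 subrr mul0mx.
  by rewrite /mxnull /= !colE mulmxA mul0mx.
by move: E22; rewrite mulmxBr mulmx1 E21 => /subr0_eq.
Qed.

Lemma eigenprojectionP A : is_eigenprojection A (eigenprojection A).
Proof.
exact: (xgetPex 0 (eigenprojection_exists A)).
Qed.

End Eigenprojection.

Section HubMatrix.
Context {R : realType} {n : nat}.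

Definition row_stochastic (P : 'M[R]_n) : Prop :=
  (forall i j, 0 <= P i j) /\ (forall i, \sum_j P i j = 1).

Definition distribution_vector (v : 'cV[R]_n) : Prop :=
  (forall i, 0 <= v i 0) /\ \sum_i v i 0 = 1.

(* At delta = 1 the square of this matrix is diag(1 v^T, 1): its powers have
   period 2 from the first on, so orbits need not converge there. *)
Definition hub_matrix (P : 'M[R]_n) (v : 'cV[R]_n) (delta : R) : 'M[R]_(n + 1) :=
  block_mx ((1 - delta) *: P) (delta *: const_mx 1) v^T 0.

End HubMatrix.

(* Main.v *)
Require Import Defs.
From mathcomp Require Import all_boot all_order all_algebra.
From mathcomp Require Import all_classical all_reals all_analysis.
From mathcomp Require Import ring lra.
Import Order.TTheory GRing.Theory Num.Theory.
Import numFieldNormedType.Exports.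
Local Open Scope classical_set_scope.
Local Open Scope ring_scope.

(* For delta < 1 the hub column of Q^2 is at least delta (1 - delta) > 0, so Q^2
   contracts the sup distance to the constant vectors (Doeblin), and the
   consensus value is read off the stationary row p of Q, since p y^k does not
   depend on k. For delta = 1 the limit is assumed to exist; it is constant
   because the top entries of y^(k+1) all equal the last entry of y^k.
   The matrix M = I + g (I - P) does not decrease the sup norm, because
   (1 + g) x = M x + g P x. Hence I - P has index at most 1, and writing
   I - J = (I - P) Z gives M^-1 - J = g^-1 (I - M^-1) Z, which tends to 0 as
   g = 1/delta - 1 grows. *)

Set Implicit Arguments.
Unset Strict Implicit.
Unset Printing Implicit Defensive.

(** * Sup norm and absolute row sums *)

Section MaxNorm.
Context {R : realDomainType}.

Lemma mx_norm_entry_le m n (x : 'M[R]_(m, n)) i j : `|x i j| <= `|x|.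
Proof.
rewrite [leRHS]/Num.norm /= mx_normrE; apply/bigmax_geP; right => /=.
by exists (i, j).
Qed.

Lemma mx_norm_le m n (x : 'M[R]_(m, n)) r :
  0 <= r -> (forall i j, `|x i j| <= r) -> `|x| <= r.
Proof.
move=> r_ge0 xr; rewrite [leLHS]/Num.norm /= mx_normrE.
by apply/bigmax_leP; split=> // -[i j] _; exact: xr.
Qed.

Lemma mx_norm_mulmx_le m n p (A : 'M[R]_(m, n)) (x : 'M[R]_(n, p)) s :
  0 <= s -> (forall i, \sum_j `|A i j| <= s) -> `|A *m x| <= s * `|x|.
Proof.
move=> s_ge0 As; apply: mx_norm_le => [|i j]; first by rewrite mulr_ge0.
rewrite mxE; apply: le_trans (ler_norm_sum _ _ _) _.
apply: le_trans (ler_wpM2r (normr_ge0 x) (As i)); rewrite mulr_suml.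
by apply: ler_sum => k _; rewrite normrM ler_wpM2l ?mx_norm_entry_le.
Qed.

End MaxNorm.

(** * Stochastic matrices and convergence of orbits to consensus *)

Section Stochastic.
Context {R : realType} {n : nat}.
Implicit Types (P Q : 'M[R]_n) (x : 'cV[R]_n) (p : 'rV[R]_n) (a c : R)
  (y : nat -> 'cV[R]_n).

Lemma stochastic_mul P Q :
  row_stochastic P -> row_stochastic Q -> row_stochastic (P *m Q).
Proof.
move=> [P_ge0 P1] [Q_ge0 Q1]; split=> [i j|i].
  by rewrite mxE sumr_ge0// => k _; rewrite mulr_ge0.
under eq_bigr do rewrite mxE.
rewrite exchange_big /= -[RHS](P1 i); apply: eq_bigr => k _.
by rewrite -mulr_sumr Q1 mulr1.
Qed.

Lemma stochastic_exp P k : row_stochastic P -> row_stochastic (P ^+ k).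
Proof.
move=> P_stoch; elim: k => [|k IH]; last first.
  by rewrite exprS; exact: stochastic_mul.
split=> [i j|i]; first by rewrite expr0 mxE ler0n.
rewrite (bigD1 i) //= big1 => [|j]; rewrite !mxE ?eqxx ?addr0//.
by rewrite eq_sym => /negPf ->.
Qed.

Lemma stochastic_mul_const P (a : R) :
  row_stochastic P -> P *m const_mx a = const_mx a :> 'cV_n.
Proof.
move=> [_ P1]; apply/colP => i; rewrite !mxE.
by under eq_bigr do rewrite mxE; rewrite -mulr_suml P1 mul1r.
Qed.

Lemma stochastic_norm_mul_le P x : row_stochastic P -> `|P *m x| <= `|x|.
Proof.
move=> [P_ge0 P1]; rewrite -[leRHS]mul1r; apply: mx_norm_mulmx_le => // i.
by under eq_bigr do rewrite ger0_norm//; rewrite P1.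
Qed.

(* Subtracting c from column j0 leaves a nonnegative matrix with row sums
   1 - c. *)
Lemma stochastic_minorized_contraction P j0 c x a :
  row_stochastic P -> (forall i, c <= P i j0) ->
  `|P *m x - const_mx (c * x j0 0 + (1 - c) * a)| <=
    (1 - c) * `|x - const_mx a|.
Proof.
move=> [P_ge0 P1] cP.
pose B := P - \matrix_(i, j) (c * (j == j0)%:R) : 'M[R]_n.
have B_ge0 i j : 0 <= B i j.
  rewrite !mxE; case: eqVneq => [->|_]; first by rewrite mulr1 subr_ge0.
  by rewrite mulr0 subr0.
have B1 i : \sum_j B i j = 1 - c.
  under eq_bigr do rewrite !mxE.
  rewrite big_split /= sumrN P1 -mulr_sumr (bigD1 j0) //= eqxx big1 => [|j].
    by rewrite addr0 mulr1.
  by move=> /negPf ->.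
have -> : P *m x - const_mx (c * x j0 0 + (1 - c) * a) = B *m (x - const_mx a).
  apply/colP => i; rewrite mulmxBr mulmxBl !mxE.
  have -> : \sum_j (\matrix_(i < n, j < n) (c * (j == j0)%:R)) i j * x j 0 =
      c * x j0 0.
    rewrite (bigD1 j0) //= big1 => [|j /negPf]; rewrite !mxE.
      by rewrite eqxx mulr1 addr0.
    by move=> ->; rewrite mulr0 mul0r.
  under [X in _ = _ - X]eq_bigr do rewrite [X in _ * X]mxE.
  rewrite -mulr_suml B1; ring.
apply: mx_norm_mulmx_le => [|i]; first by rewrite -(B1 j0) sumr_ge0.
by under eq_bigr do rewrite ger0_norm//; rewrite B1.
Qed.

Lemma stationary_orbit Q p y k :
  p *m Q = p -> (forall j, y j.+1 = Q *m y j) -> p *m y k = p *m y 0%N.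
Proof. by move=> pQ yS; elim: k => // k <-; rewrite yS mulmxA pQ. Qed.

(** The matrix [1 p] fixes constant vectors because [p 1 = 1]. Each of its rows is [p], whose
    entries may have any sign, hence the l1 norm as factor. *)
Lemma stationary_consensus_le p x a :
  p *m (const_mx 1 : 'cV_n) = 1%:M ->
  `|(const_mx 1 : 'cV_n) *m p *m x - const_mx a| <=
    (\sum_j `|p 0 j|) * `|x - const_mx a|.
Proof.
move=> p1.
have pa : const_mx a = (const_mx 1 : 'cV_n) *m p *m const_mx a :> 'cV[R]_n.
  have -> : const_mx a = a *: const_mx 1 :> 'cV[R]_n.
    by apply/colP => i; rewrite !mxE mulr1.
  by rewrite -scalemxAr -mulmxA p1 mulmx1.
rewrite [in leLHS]pa -mulmxBr.
apply: mx_norm_mulmx_le => [|i]; first exact: sumr_ge0.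
by apply: ler_sum => j _; rewrite !mxE big_ord1 !mxE mul1r.
Qed.

(** By invariance [1 p y^0 = 1 p y^k] for every [k], and this vector lies within [K] times the
    distance from [y^k] to the limit. *)
Lemma stationary_cvg_consensus Q p y a :
  p *m Q = p -> p *m (const_mx 1 : 'cV_n) = 1%:M ->
  (forall k, y k.+1 = Q *m y k) -> y k @[k --> \oo] --> (const_mx a : 'cV_n) ->
  const_mx a = (const_mx 1 : 'cV_n) *m p *m y 0%N.
Proof.
move=> pQ p1 yS ya; apply/eqP; rewrite eq_sym -subr_eq0 -normr_le0.
apply/ler_addgt0Pr => e e_gt0; rewrite add0r.
pose K : R := \sum_j `|p 0 j|.
have K_ge0 : 0 <= K by exact: sumr_ge0.
have eK_gt0 : 0 < e / (K + 1) by rewrite divr_gt0// ltr_wpDl.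
have [k _ /(_ k (leqnn k)) /= yk] := cvgr_distC_le _ _ ya _ eK_gt0.
rewrite -mulmxA -(stationary_orbit k pQ yS) mulmxA.
apply: le_trans (stationary_consensus_le _ _ p1) _.
apply: le_trans (ler_wpM2l K_ge0 yk) _.
by rewrite mulrCA ler_piMr ?(ltW e_gt0)// ler_pdivrMr ?ltr_wpDl// mul1r lerDl.
Qed.

(** Every [N] steps shrink the distance to a suitable constant vector by [1 - c]. These constants
    vary with [q], and their convergence is never proved: the invariant [p y] places [1 p y^0] near
    each of them. *)
Lemma minorized_orbit_cvg Q p y N j0 c :
  row_stochastic Q -> 0 < c -> (forall i, c <= (Q ^+ N) i j0) ->
  p *m Q = p -> p *m (const_mx 1 : 'cV_n) = 1%:M ->
  (forall k, y k.+1 = Q *m y k) ->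
  y k @[k --> \oo] --> (const_mx 1 : 'cV_n) *m p *m y 0%N.
Proof.
move=> Qs c_gt0 cQ pQ p1 yS; have QNs := stochastic_exp N Qs.
have yD k j : y (k + j)%N = Q ^+ k *m y j.
  by elim: k => [|k IH]; rewrite ?mul1mx// addSn yS IH mulmxA exprS.
have c_le1 : c <= 1.
  apply: le_trans (cQ j0) _; rewrite -(QNs.2 j0) (bigD1 j0)//= lerDl.
  by apply: sumr_ge0 => j _; exact: QNs.1.
have near_const q : exists a,
    `|y (q * N)%N - const_mx a| <= (1 - c) ^+ q * `|y 0%N|.
  elim: q => [|q [a ya]].
    by exists 0; rewrite mul1r mul0n (_ : const_mx 0 = 0) ?subr0.
  exists (c * y (q * N)%N j0 0 + (1 - c) * a); rewrite mulSn yD.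
  apply: le_trans (stochastic_minorized_contraction _ _ QNs cQ) _.
  by rewrite exprS -mulrA ler_wpM2l// subr_ge0.
have keep a k j : `|y (j + k)%N - const_mx a| <= `|y k - const_mx a|.
  elim: j => // j; apply: le_trans; rewrite addSn yS.
  rewrite -[const_mx a in leLHS](stochastic_mul_const a Qs) -mulmxBr.
  exact: stochastic_norm_mul_le.
pose K : R := \sum_j `|p 0 j|.
have K_ge0 : 0 <= K by exact: sumr_ge0.
(* The factor [1 + K] counts one distance from [y^j] to the constant [a] and [K] of them from [a] to
   [1 p y^j]. *)
have geo : ((1 + K) * `|y 0%N|) * (1 - c) ^+ q @[q --> \oo] --> 0.
  rewrite -[0](mulr0 ((1 + K) * `|y 0%N|)); apply: cvgM; first exact: cvg_cst.
  by apply: cvg_expr; rewrite ger0_norm ?subr_ge0// ltrBlDr ltrDl.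
apply/cvgrPdist_le => e e_gt0.
have [q _ /(_ q (leqnn q)) /= qe] := cvgr0_norm_le _ geo _ e_gt0.
have [a ya] := near_const q.
exists (q * N)%N => // j /= /subnK <-.
rewrite -mulmxA -(stationary_orbit (j - q * N + q * N) pQ yS) mulmxA.
set z := y _.
have za : `|z - const_mx a| <= (1 - c) ^+ q * `|y 0%N|.
  exact: le_trans (keep _ _ _) ya.
apply: le_trans qe; apply: le_trans (ler_norm _).
rewrite -mulrA [`|y 0%N| * _]mulrC.
apply: le_trans (ler_wpM2l _ za); last by rewrite addr_ge0.
rewrite -(subrK (const_mx a) (_ *m z)) -addrA mulrDl mul1r addrC.
apply: le_trans (ler_normD _ _) _; rewrite distrC lerD2l.
exact: stationary_consensus_le.
Qed.

End Stochastic.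

(** * Eigenprojections of matrices of index at most one *)

Section IndexOne.
Context {F : fieldType} {n : nat}.
Implicit Types A E : 'M[F]_n.

(** By rank-nullity the rank lost in squaring is the dimension of the intersection of range and
    kernel, which the hypothesis makes zero. Transposes translate columns into row spaces. *)
Lemma mxrank_sqr_eq A :
  (forall x : 'cV_n, A *m (A *m x) = 0 -> A *m x = 0) ->
  \rank (A ^+ 2) = \rank A.
Proof.
move=> kerA; rewrite expr2 -mxrank_tr trmx_mul -[RHS]mxrank_tr.
rewrite -[RHS](mxrank_mul_ker A^T A^T).
suff -> : (A^T :&: kermx A^T)%MS = 0 by rewrite mxrank0 addn0.
apply/eqP/rowV0P => u; rewrite sub_capmx => /andP[/submxP[w ->]].
move=> /sub_kermxP wAA; apply: trmx_inj; rewrite trmx_mul trmxK trmx0.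
apply: kerA; apply: trmx_inj.
by rewrite !trmx_mul !trmxK trmx0.
Qed.

Lemma mxrange_col A (B : 'M[F]_n) :
  (forall x : 'cV_n, mxrange B (A *m x)) -> exists Z, A = B *m Z.
Proof.
move=> AB; suff : (A^T <= B^T)%MS.
  by move=> /submxP[Z eZ]; exists Z^T; apply: trmx_inj; rewrite trmx_mul trmxK.
apply/row_subP => i; have [z _ eBz] := AB (delta_mx i 0).
apply/submxP; exists z^T; rewrite -trmx_mul eBz trmx_mul trmx_delta.
by rewrite rowE.
Qed.

Lemma eigenprojection_index_le1 A :
  \rank (A ^+ 2) = \rank A ->
  A *m eigenprojection A = 0 /\
  exists Z, 1%:M - eigenprojection A = A *m Z.
Proof.
set E := eigenprojection A => rkA.
have [EE rE nE] : is_eigenprojection A E by exact: eigenprojectionP.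
have [idx_le1 rk_idx] : (mxindex A <= 1)%N /\
    \rank (A ^+ (mxindex A).+1) = \rank (A ^+ mxindex A).
  rewrite /mxindex; case: ex_minnP => m /eqP rkm min_m; split=> //.
  by apply: min_m; rewrite expr1 rkA.
have AE0 : A ^+ mxindex A *m E = 0.
  have sub : mxrange E `<=` mxnull (A ^+ mxindex A) by rewrite rE.
  apply/matrixP => i j.
  have /sub /= : mxrange E (col j E) by exists (delta_mx j 0); rewrite -?colE.
  by rewrite /mxnull /= colE mulmxA -colE => /colP/(_ i); rewrite !mxE.
have ErA : exists Z, 1%:M - E = A ^+ mxindex A *m Z.
  apply: mxrange_col => x; rewrite -nE /mxnull /=.
  by rewrite mulmxA mulmxBr mulmx1 EE subrr mul0mx.
(* Index 1 is immediate. At index 0 the power is the identity, so [E = 0] and [A] is invertible. *)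
case: (mxindex A) idx_le1 rk_idx AE0 ErA => [|[|//]] _; last first.
  by rewrite expr1.
rewrite expr1 expr0 mxrank1 mul1mx => rk_n -> [Z ->].
split; first exact: mulmx0.
have Aunit : A \in unitmx by rewrite -row_full_unit /row_full rk_n.
by exists (invmx A *m Z); rewrite mulmxA mulmxV.
Qed.

End IndexOne.

(** * The resolvent of a stochastic matrix and its limit *)

Section Resolvent.
Context {R : realType} {n : nat}.
Variable P : 'M[R]_n.
Hypothesis P_stoch : row_stochastic P.
Implicit Types (x : 'cV[R]_n) (g : R).

Let res g : 'M[R]_n := 1%:M + g *: (1%:M - P).

(** This lower bound gives both the invertibility of the matrix and the nonexpansiveness of its
    inverse. *)
Lemma resolvent_norm_ge g x :
  0 <= g -> `|x| <= `|(1%:M + g *: (1%:M - P)) *m x|.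
Proof.
move=> g_ge0; rewrite -(lerD2r (g * `|x|)).
have -> : `|x| + g * `|x| = `|(1 + g) *: x|.
  by rewrite normrZ ger0_norm ?addr_ge0// mulrDl mul1r.
have -> : (1 + g) *: x = res g *m x + g *: (P *m x).
  by rewrite mulmxDl mul1mx -scalemxAl mulmxBl mul1mx scalerBr scalerDl scale1r
    -addrA subrK.
apply: le_trans (ler_normD _ _) _; rewrite lerD2l normrZ ger0_norm//.
by rewrite ler_wpM2l// stochastic_norm_mul_le.
Qed.

Lemma resolvent_unit g : 0 <= g -> 1%:M + g *: (1%:M - P) \in unitmx.
Proof.
(* The bound concerns columns while [kermx] is a left kernel, hence the transpose. *)
move=> g_ge0; rewrite -unitmx_tr -row_free_unit -kermx_eq0.
apply/rowV0P => u /sub_kermxP uM; apply: trmx_inj; rewrite trmx0.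
apply/eqP; rewrite -normr_le0; apply: le_trans (resolvent_norm_ge _ g_ge0) _.
by rewrite -[_ *m _]trmxK trmx_mul trmxK uM trmx0 normr0.
Qed.

Lemma resolvent_inv_norm_le g x :
  0 <= g -> `|invmx (1%:M + g *: (1%:M - P)) *m x| <= `|x|.
Proof.
move=> g_ge0; apply: le_trans (resolvent_norm_ge _ g_ge0) _.
by rewrite mulKVmx ?resolvent_unit.
Qed.

(* If y = (I - P) x is killed by I - P then the resolvent matrix fixes y and
   maps x to x + g y, so that g y stays bounded by 2|x| for all g. *)
Lemma mxrank_stochastic_sqr : \rank ((1%:M - P) ^+ 2) = \rank (1%:M - P).
Proof.
apply: mxrank_sqr_eq => x; set y := _ *m x => Py.
have yg g : 0 <= g -> g * `|y| <= `|x| + `|x|.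
  move=> g_ge0; rewrite -[g]ger0_norm// -normrZ.
  have My : res g *m y = y.
    by rewrite mulmxDl mul1mx -scalemxAl Py scaler0 addr0.
  (* Applying the inverse to [g *: y = res g *m x - x] leaves [x] minus a vector of norm at most
     [|x|], a bound free of [g]. *)
  have -> : g *: y = invmx (res g) *m (g *: y).
    by rewrite -[in RHS]My -scalemxAr mulKmx// resolvent_unit.
  have -> : g *: y = res g *m x - x.
    by rewrite mulmxDl mul1mx -scalemxAl addrAC subrr add0r.
  rewrite mulmxBr mulKmx ?resolvent_unit//.
  by apply: le_trans (ler_normB _ _) _; rewrite lerD2l resolvent_inv_norm_le.
apply/eqP; rewrite -normr_le0 leNgt; apply/negP => y_gt0.
(* This [g] turns the bound into [2|x| + 1 <= 2|x|]. *)
have := yg ((`|x| + `|x| + 1) / `|y|); rewrite divr_ge0 ?addr_ge0// => /(_ isT).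
by rewrite divfK ?gt_eqF// leNgt ltrDl ltr01.
Qed.

Lemma resolvent_eigenprojection_le x :
  exists C, forall g, 0 < g ->
    `|invmx (1%:M + g *: (1%:M - P)) *m x - eigenprojection (1%:M - P) *m x|
      <= C / g.
Proof.
have [AE [Z AZ]] := eigenprojection_index_le1 mxrank_stochastic_sqr.
set E := eigenprojection _ in AE AZ *.
(* The inverse is nonexpansive, so [Z x] minus its image has norm at most [2|Z x|]. *)
exists (`|Z *m x| + `|Z *m x|) => g g_gt0.
have Mu : res g \in unitmx by rewrite resolvent_unit// ltW.
have ME : invmx (res g) *m E = E.
  rewrite -[in LHS](_ : res g *m E = E) ?mulKmx//.
  by rewrite mulmxDl mul1mx -scalemxAl AE scaler0 addr0.
have -> : invmx (res g) *m x - E *m x =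
    g^-1 *: (Z *m x - invmx (res g) *m (Z *m x)).
  have -> : invmx (res g) *m x - E *m x = invmx (res g) *m ((1%:M - E) *m x).
    by rewrite mulmxBl mul1mx mulmxBr [in RHS]mulmxA ME.
  have -> : 1%:M - E = g^-1 *: (res g - 1%:M) *m Z.
    rewrite AZ /res [X in _ *: X]addrAC subrr add0r scalerA.
    by rewrite mulVf ?scale1r// gt_eqF.
  by rewrite -!scalemxAl -scalemxAr !mulmxBl mul1mx mulmxBr -mulmxA mulKmx.
rewrite normrZ gtr0_norm ?invr_gt0// [leRHS]mulrC.
rewrite ler_wpM2l ?invr_ge0 ?(ltW g_gt0)//.
apply: le_trans (ler_normB _ _) _; rewrite lerD2l resolvent_inv_norm_le//.
exact: ltW.
Qed.

End Resolvent.

(** * The hub matrix, its stationary row, and the limit as [delta] tends to 0 *)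

Section Hub.
Context {R : realType} {n : nat}.
Variables (P : 'M[R]_n) (v : 'cV[R]_n).
Hypotheses (P_stoch : row_stochastic P) (v_distr : distribution_vector v).
Implicit Types (delta : R) (y : nat -> 'cV[R]_(n + 1)).

Let Q delta := hub_matrix P v delta.

(** For [0 < delta <= 1] this is a left eigenvector of the hub matrix for eigenvalue 1. Its blocks
    have sums 1 and [delta] before normalization. *)
Definition hub_stationary delta : 'rV[R]_(n + 1) :=
  (1 + delta)^-1 *:
    row_mx (v^T *m invmx (1%:M + (delta^-1 - 1) *: (1%:M - P))) delta%:M.

Lemma distribution_mul_const : v^T *m (const_mx 1 : 'cV_n) = 1%:M.
Proof.
apply/matrixP => i j; rewrite !ord1 !mxE -[RHS]v_distr.2.
by apply: eq_bigr => k _; rewrite !mxE mulr1.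
Qed.

Lemma hub_matrix_stochastic delta :
  0 <= delta <= 1 -> row_stochastic (Q delta).
Proof.
move=> /andP[d_ge0 d_le1]; have dC : 0 <= 1 - delta by rewrite subr_ge0.
have [[P_ge0 P1] [v_ge0 v1]] := (P_stoch, v_distr).
split=> [i j|i].
  case: (split_ordP i) => k ->; case: (split_ordP j) => l ->.
  - by rewrite block_mxEul mxE mulr_ge0.
  - by rewrite block_mxEur !mxE mulr1.
  - by rewrite block_mxEdl mxE ord1.
  - by rewrite block_mxEdr mxE.
rewrite big_split_ord /= big_ord1; case: (split_ordP i) => k ->.
  rewrite (eq_bigr (fun j => (1 - delta) * P k j)) => [|j _].
    by rewrite -mulr_sumr P1 block_mxEur !mxE !mulr1 subrK.
  by rewrite block_mxEul mxE.
rewrite (eq_bigr (fun j => v j 0)) => [|j _].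
  by rewrite v1 block_mxEdr mxE addr0.
by rewrite block_mxEdl mxE ord1.
Qed.

(** Two steps reach the hub with weight [(1 - delta) * delta] from a top index and [delta] from the
    hub. One step does not suffice, as the hub's diagonal entry is 0. *)
Lemma hub_matrix_sqr_hub_col delta i : 0 <= delta <= 1 ->
  delta * (1 - delta) <= (Q delta ^+ 2) i (rshift n 0).
Proof.
move=> /andP[d_ge0 d_le1].
rewrite (_ : Q delta ^+ 2 = Q delta *m Q delta) ?expr2//.
rewrite /Q /hub_matrix mulmx_block.
case: (split_ordP i) => k ->.
  rewrite block_mxEur -scalemxAr -!scalemxAl stochastic_mul_const//.
  by rewrite mulmx0 scaler0 addr0 !mxE mulr1.
rewrite block_mxEdr -scalemxAr distribution_mul_const mulmx0 addr0.
by rewrite !mxE ord1 /= mulr1 ler_piMr// lerBlDr lerDl.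
Qed.

Section Stationary.
Variable delta : R.
Hypotheses (d_gt0 : 0 < delta) (d_le1 : delta <= 1).

Let g_ge0 : 0 <= delta^-1 - 1.
Proof. by rewrite subr_ge0 invf_ge1. Qed.

Let res := 1%:M + (delta^-1 - 1) *: (1%:M - P).

Let res_unit : res \in unitmx.
Proof. exact: resolvent_unit. Qed.

Let res_inv_const : invmx res *m const_mx 1 = (const_mx 1 : 'cV_n).
Proof.
rewrite -[in LHS](_ : res *m const_mx 1 = (const_mx 1 : 'cV_n)) ?mulKmx//.
rewrite mulmxDl mul1mx -scalemxAl mulmxBl mul1mx stochastic_mul_const//.
by rewrite subrr scaler0 addr0.
Qed.

Lemma hub_stationary_mul_const :
  hub_stationary delta *m (const_mx 1 : 'cV_(n + 1)) = 1%:M.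
Proof.
have -> : const_mx 1 = col_mx (const_mx 1) (const_mx 1) :> 'cV[R]_(n + 1).
  by apply/colP => i; rewrite !mxE; case: fintype.split => ?; rewrite mxE.
rewrite -scalemxAl mul_row_col -mulmxA -/res res_inv_const.
rewrite distribution_mul_const; apply/matrixP => i j.
rewrite !ord1 !mxE big_ord1 !mxE /= mulr1.
by rewrite mulVf// gt_eqF// addr_gt0.
Qed.

(** The choice of [gamma] makes [delta *: res = I - (1 - delta) P], so in the left block the term
    [- delta v^T] cancels against the contribution of the hub row. *)
Lemma hub_stationary_mul_hub :
  hub_stationary delta *m Q delta = hub_stationary delta.
Proof.
rewrite /hub_stationary -scalemxAl; congr (_ *: _).
have dres : delta *: res = 1%:M - (1 - delta) *: P.
  rewrite scalerDr scalerA mulrBr mulr1 divff ?gt_eqF// scalerBr.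
  by rewrite addrA -scalerDl [delta + _]addrC subrK scale1r.
rewrite mul_row_block -/res; congr row_mx.
  have -> : (1 - delta) *: P = 1%:M - delta *: res.
    by rewrite dres subKr.
  by rewrite mulmxBr mulmx1 -scalemxAr mulmxKV// mul_scalar_mx subrK.
rewrite mulmx0 addr0 -scalemxAr -mulmxA res_inv_const distribution_mul_const.
by rewrite scalemx1.
Qed.

End Stationary.

Lemma hub_orbit_lim1_const y :
  (forall k, y k.+1 = hub_matrix P v 1 *m y k) -> cvgn y ->
  exists a : R, y k @[k --> \oo] --> (const_mx a : 'cV[R]_(n + 1)).
Proof.
move=> yS ycvg; exists (limn y (rshift n 0) 0).
suff -> : const_mx (limn y (rshift n 0) 0) = limn y by [].
have entry i : y k i 0 @[k --> \oo] --> limn y i 0.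
  exact: (cvg_comp _ _ ycvg (@coord_continuous _ _ _ i 0 (limn y))).
apply/colP => i; rewrite mxE; case: (split_ordP i) => j -> {i}; last first.
  by rewrite (ord1 j).
apply: (cvg_unique (@norm_hausdorff _ R^o)) (entry (rshift n 0)) _.
(* At [delta = 1] the block [(1 - delta) P] vanishes, so each top entry is the hub entry delayed by
   one step and has the same limit. *)
have -> : (fun k => y k (rshift n 0) 0) = (fun k => y k.+1 (lshift 1 j) 0).
  apply/funext => k; rewrite yS mxE big_split_ord /= big_ord1.
  rewrite big1 => [|l _]; first by rewrite block_mxEur !mxE !mul1r add0r.
  by rewrite block_mxEul mxE subrr !mul0r.
by have := entry (lshift 1 j); rewrite -cvg_shiftS.
Qed.

(** The minorization constant [delta * (1 - delta)] vanishes at [delta = 1]; there convergence is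
    assumed and only the value is computed. *)
Lemma hub_orbit_cvg delta y : 0 < delta <= 1 ->
  (forall k, y k.+1 = hub_matrix P v delta *m y k) -> (delta = 1 -> cvgn y) ->
  y k @[k --> \oo] -->
    (const_mx 1 : 'cV[R]_(n + 1)) *m hub_stationary delta *m y 0%N.
Proof.
move=> /andP[d_gt0]; rewrite le_eqVlt.
move=> /predU1P[->{delta d_gt0}|d_lt1] yS ycvg.
  have [a ya] := hub_orbit_lim1_const yS (ycvg erefl).
  rewrite -(stationary_cvg_consensus _ _ yS ya)//.
    exact: hub_stationary_mul_hub.
  exact: hub_stationary_mul_const.
have d01 : 0 <= delta <= 1 by rewrite !ltW.
have Q_stoch := hub_matrix_stochastic d01.
apply: (@minorized_orbit_cvg _ _ (hub_matrix P v delta) _ _ 2 (rshift n 0)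
  (delta * (1 - delta))) => //.
- by rewrite mulr_gt0// subr_gt0.
- by move=> i; exact: hub_matrix_sqr_hub_col.
- by apply: hub_stationary_mul_hub => //; exact: ltW.
- by apply: hub_stationary_mul_const => //; exact: ltW.
Qed.

Lemma hub_stationary_cvg0 (y0 : 'cV[R]_(n + 1)) :
  (const_mx 1 : 'cV[R]_(n + 1)) *m hub_stationary delta *m y0
    @[delta --> 0^'+] -->
  (const_mx 1 : 'cV[R]_(n + 1)) *m
    row_mx (v^T *m eigenprojection (1%:M - P)) 0 *m y0.
Proof.
set J := eigenprojection _; pose one : 'cV[R]_(n + 1) := const_mx 1.
pose M delta : 'M[R]_n := invmx (1%:M + (delta^-1 - 1) *: (1%:M - P)).
pose x := usubmx y0; pose h := one *m dsubmx y0.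
have y0E : y0 = col_mx x (dsubmx y0) by rewrite vsubmxK.
(* The limit is written as the orbit formula with [delta] set to 0, so that limits can be taken term
   by term. *)
have -> : one *m row_mx (v^T *m J) 0 *m y0 =
    (1 + 0)^-1 *: (one *m v^T *m (J *m x) + 0 *: h).
  rewrite y0E -mulmxA mul_row_col mul0mx !addr0 invr1 scale1r scale0r addr0.
  by rewrite !mulmxA.
rewrite (_ : (fun delta => _) = fun delta =>
    (1 + delta)^-1 *: (one *m v^T *m (M delta *m x) + delta *: h)); last first.
  apply/funext => delta; rewrite /hub_stationary -scalemxAr -scalemxAl.
  congr (_ *: _).
  rewrite [in LHS]y0E -[LHS]mulmxA mul_row_col mul_scalar_mx mulmxDr -scalemxAr.
  by rewrite !mulmxA.
have id0 : (delta : R) @[delta --> 0^'+] --> (0 : R).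
  exact: cvg_within.
apply: cvgZ.
  apply: cvgV; first by rewrite addr0 oner_eq0.
  by apply: cvgD => //; exact: cvg_cst.
apply: cvgD; last exact: cvgZr_tmp.
have [C MJ] := resolvent_eigenprojection_le P_stoch x.
apply/cvgrPdist_le => e e_gt0.
(* For [delta < 1/2] one has [delta^-1 - 1 > 1 / (2 delta)], so [C / g] is at most [2 C delta]. *)
have C_near : \forall delta \near (0 : R)^'+, `|2 * C * delta| <= e.
  have : 2 * C * delta @[delta --> (0:R)^'+] --> 2 * C * 0.
    by apply: cvgM => //; exact: cvg_cst.
  by rewrite mulr0 => /cvgr0_norm_le; apply.
near=> delta.
have d_gt0 : 0 < delta by [].
have d_lt : delta < 2^-1 by near: delta; exact: nbhs_right_lt.
rewrite -mulmxBr; apply: le_trans (_ : 1 * `|J *m x - M delta *m x| <= _).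
  apply: mx_norm_mulmx_le => // i; rewrite -[leRHS]v_distr.2.
  apply: ler_sum => j _; rewrite !mxE big_ord1 !mxE mul1r.
  by rewrite ger0_norm// v_distr.1.
rewrite mul1r distrC.
have g_gt0 : 0 < delta^-1 - 1 by rewrite subr_gt0 invf_gt1//; lra.
apply: le_trans (MJ _ g_gt0) _.
(* The sign of [C] is read off from the bound at [g = 1]. *)
have C_ge0 : 0 <= C.
  have := le_trans (normr_ge0 _) (MJ _ (ltr01)).
  by rewrite divr1.
apply: le_trans (_ : `|2 * C * delta| <= e); last by near: delta.
apply: le_trans (ler_norm _).
(* What remains is [C <= 2 C - 2 C delta], that is [C (1 - 2 delta) >= 0]. *)
rewrite ler_pdivrMr// mulrBr mulfK ?gt_eqF// mulr1; nra.
Unshelve. all: by end_near. Qed.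

End Hub.

Unset Implicit Arguments.

Theorem theorem4 (R : realType) (n : nat) (P : 'M[R]_n) (v : 'cV[R]_n)
  (hP : row_stochastic P) (hv : distribution_vector v) :
  (forall (delta : R) (y : nat -> 'cV[R]_(n + 1)),
     0 < delta <= 1 ->
     (forall k, y k.+1 = hub_matrix P v delta *m y k) ->
     let gamma := delta^-1 - 1 in
     (1%:M + gamma *: (1%:M - P)) \in unitmx /\
     ((delta = 1 -> cvgn y) ->
      y k @[k --> \oo] -->
        (const_mx 1 : 'cV[R]_(n + 1)) *m
        ((1 + delta)^-1 *:
           row_mx (v^T *m invmx (1%:M + gamma *: (1%:M - P))) delta%:M) *m
        y 0%N))
  /\
  (forall (y0 : 'cV[R]_(n + 1)) (y : R -> nat -> 'cV[R]_(n + 1)),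
     (forall delta : R, 0 < delta <= 1 ->
        y delta 0%N = y0 /\
        forall k, y delta k.+1 = hub_matrix P v delta *m y delta k) ->
     let J := eigenprojection (1%:M - P) in
     (limn (y delta) @[delta --> 0^'+] -->
        (const_mx 1 : 'cV[R]_(n + 1)) *m row_mx (v^T *m J) 0 *m y0)
     /\
     (v = n%:R^-1 *: const_mx 1 ->
      limn (y delta) @[delta --> 0^'+] -->
        (n%:R^-1 * \sum_(j < n) (\sum_(i < n) J i j) * y0 (lshift 1 j) 0) *:
        (const_mx 1 : 'cV[R]_(n + 1)))).
Proof.
split=> [delta y d01 yS gamma|y0 y yS J].
  split=> [|ycvg]; last exact: hub_orbit_cvg.
  move/andP: d01 => [d_gt0 d_le1]; apply: resolvent_unit => //.
  by rewrite subr_ge0 invf_ge1.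
have lim_y : limn (y delta) @[delta --> 0^'+] -->
    (const_mx 1 : 'cV[R]_(n + 1)) *m row_mx (v^T *m J) 0 *m y0.
  (* Near [0^'+] one has [delta < 1], so the orbits converge unconditionally and [limn] is given by
     the stationary row. *)
  apply: cvg_trans (hub_stationary_cvg0 hP hv (y0 := y0)); apply: near_eq_cvg.
  near=> delta.
  have d_gt0 : 0 < delta by [].
  have d_lt1 : delta < 1 by near: delta; exact: nbhs_right_lt.
  have d01 : 0 < delta <= 1 by rewrite d_gt0 ltW.
  have [<- yS'] := yS delta d01.
  apply/esym/cvg_lim; first exact: norm_hausdorff.
  by apply: hub_orbit_cvg => // d1; rewrite d1 ltxx in d_lt1.
(* For uniform [v] the limit is the same vector: the hub entry of [y0] meets the block 0, and the
   rest expands into the double sum. *)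
split=> // vE; move: lim_y; congr (_ --> _).
rewrite -[in LHS](vsubmxK y0) -mulmxA mul_row_col mul0mx addr0.
apply/colP => i; rewrite !mxE big_ord1 !mxE mul1r mulr1 mulr_sumr.
apply: eq_bigr => j _; rewrite mxE mulrA mulr_sumr.
congr (_ * _); last by rewrite mxE.
by apply: eq_bigr => k _; rewrite vE !mxE mulr1.
Unshelve. all: by end_near. Qed.
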